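(* Let $M\in\mathbb{R}^{d\times d}$ be symmetric positive definite, and let $\mathbf u_1,\dots,\mathbf u_n\in\mathbb{R}^d$ be nonzero row covectors (the normals of $n$ contact manifolds) that are pairwise orthogonal: $\langle\mathbf u_i,\mathbf u_j\rangle_g=0$ for all $i\ne j$. Let $\mathbf p\in\mathbb{R}^d$ be an infeasible momentum covector with $\langle\mathbf u_i,\mathbf p\rangle_g<0$ for all $i$. Then $$\mathbf p_f=\mathbf p\prod_{i=1}^n\Gamma(\mathbf u_i)$$ is the same for every ordering of the indices $i$ in the product, and $\mathbf p_f$ is feasible, i.e. $\langle\mathbf p_f,\mathbf u_i\rangle_g\ge0$ for all $i$.
   Context: Covectors (elements of the cotangent space at the impact configuration) are row vectors in $\mathbb{R}^d$, and $M$ is the (symmetric positive definite) mass matrix at that configuration. The inner product and norm on covectors are $\langle \mathbf a,\mathbf b\rangle_g=\mathbf a M^{-1}\mathbf b^{T}$ and $\|\mathbf a\|_g=\sqrt{\langle\mathbf a,\mathbf a\rangle_g}$. For a nonzero covector $\mathbf w$, the reset map is the matrix $\Gamma(\mathbf w)=I-2\frac{M^{-1}\mathbf w^{T}\mathbf w}{\mathbf w M^{-1}\mathbf w^{T}}$, acting on row covectors from the right, i.e. $\mathbf p\,\Gamma(\mathbf w)=\mathbf p-2\frac{\langle\mathbf p,\mathbf w\rangle_g}{\|\mathbf w\|_g^2}\mathbf w$. Products are ordered from left to right. A covector is feasible if its inner product $\langle\cdot,\cdot\rangle_g$ with every contact normal $\mathbf u_i$ is $\ge0$, and infeasible otherwise.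 *)

(* Defs.v *)
From mathcomp Require Import all_boot all_order all_algebra all_fingroup.
From mathcomp Require Import reals.

Set Implicit Arguments.
Unset Strict Implicit.
Unset Printing Implicit Defensive.

Import Order.TTheory GRing.Theory Num.Theory.

Local Open Scope ring_scope.

Definition sym_posdef (R : realType) (d : nat) (M : 'M[R]_d) : Prop :=
  M^T = M /\ forall x : 'rV[R]_d, x != 0 -> 0 < (x *m M *m x^T) 0 0.

(* The product is a 1 x 1 matrix; its only entry is the scalar. *)
Definition covdot (R : realType) (d : nat) (M : 'M[R]_d) (a b : 'rV[R]_d) : R :=
  (a *m invmx M *m b^T) 0 0.

(* Meant for w != 0: the scalar inverse is total, with 0^-1 = 0.
   Covectors are rows, so the map p |-> p *m reset M w applies it. *)
Definition reset (R : realType) (d : nat) (M : 'M[R]_d) (w : 'rV[R]_d) : 'M[R]_d :=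
  1%:M - (2 / covdot M w w) *: (invmx M *m w^T *m w).

Definition feasible (R : realType) (d n : nat) (M : 'M[R]_d)
    (u : 'I_n -> 'rV[R]_d) (p : 'rV[R]_d) : Prop :=
  forall i : 'I_n, 0 <= covdot M p (u i).

(* Main.v *)
(* Reflecting in u_j changes p only along u_j, and by orthogonality leaves
   <p, u_i> unchanged for i <> j. Hence successive reflections subtract the
   independent terms 2 <p, u_i> / <u_i, u_i> u_i, whose sum is insensitive to the
   ordering, and the result has inner product - <p, u_i> > 0 with each u_i. *)

Require Import Defs.
From mathcomp Require Import all_boot all_order all_algebra all_fingroup reals.

Set Implicit Arguments.
Unset Strict Implicit.
Unset Printing Implicit Defensive.

Import Order.TTheory GRing.Theory Num.Theory.

Local Open Scope ring_scope.

(** A row [x] of the left kernel has [x *m M = 0], so its quadratic form vanishes and positivity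
    forces [x = 0]. *)
Lemma sym_posdef_unitmx (R : realType) (d : nat) (M : 'M[R]_d) :
  sym_posdef M -> M \in unitmx.
Proof.
case=> _ M_pos; rewrite -row_free_unit -kermx_eq0; apply/eqP/row_matrixP => i.
rewrite row0; apply/eqP/negPn/negP => /M_pos.
by rewrite -row_mul mulmx_ker row0 mul0mx mxE ltxx.
Qed.

Lemma covdotC (R : realType) (d : nat) (M : 'M[R]_d) (a b : 'rV[R]_d) :
  M^T = M -> covdot M a b = covdot M b a.
Proof.
move=> M_sym; rewrite /covdot.
(* A 1 x 1 matrix and its transpose have the same entry. *)
suff -> : a *m invmx M *m b^T = (b *m invmx M *m a^T)^T by rewrite mxE.
by rewrite !trmx_mul trmxK trmx_inv M_sym mulmxA.
Qed.

Lemma covdotBl (R : realType) (d : nat) (M : 'M[R]_d) (a b c : 'rV[R]_d) :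
  covdot M (a - b) c = covdot M a c - covdot M b c.
Proof. by rewrite /covdot !mulmxBl !mxE. Qed.

Lemma covdotZl (R : realType) (d : nat) (M : 'M[R]_d) (k : R) (a b : 'rV[R]_d) :
  covdot M (k *: a) b = k * covdot M a b.
Proof. by rewrite /covdot -!scalemxAl mxE. Qed.

Lemma covdot_suml (R : realType) (d : nat) (M : 'M[R]_d) (I : Type) (r : seq I)
    (P : pred I) (F : I -> 'rV[R]_d) (b : 'rV[R]_d) :
  covdot M (\sum_(i <- r | P i) F i) b = \sum_(i <- r | P i) covdot M (F i) b.
Proof. by rewrite /covdot !mulmx_suml summxE. Qed.

(** Positivity passes from [M] to its inverse by evaluating the form of [M] at [w *m invmx M]. *)
Lemma covdot_gt0 (R : realType) (d : nat) (M : 'M[R]_d) (w : 'rV[R]_d) :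
  sym_posdef M -> w != 0 -> 0 < covdot M w w.
Proof.
move=> M_spd w_neq0; have M_unit := sym_posdef_unitmx M_spd.
case: M_spd => M_sym M_pos.
have wVM_neq0 : w *m invmx M != 0.
  by apply: contraNneq w_neq0 => wVM0; rewrite -[w](mulmxKV M_unit) wVM0 mul0mx.
have := M_pos _ wVM_neq0.
by rewrite mulmxKV // trmx_mul trmx_inv M_sym mulmxA.
Qed.

Lemma mulmx_reset (R : realType) (d : nat) (M : 'M[R]_d) (p w : 'rV[R]_d) :
  p *m reset M w = p - (2 * covdot M p w / covdot M w w) *: w.
Proof.
rewrite /reset mulmxBr mulmx1 -scalemxAr !mulmxA.
by rewrite [p *m _ *m _]mx11_scalar mul_scalar_mx scalerA mulrAC.
Qed.

(** Lists allow induction on the last factor, which acts last on a row. Every coefficient involves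
    the original [p], not the partially reflected one. *)
Lemma mulmx_prod_reset (R : realType) (d : nat) (M : 'M[R]_d) (I : eqType)
    (u : I -> 'rV[R]_d) (p : 'rV[R]_d) (r : seq I) :
    (forall i j, i != j -> covdot M (u i) (u j) = 0) -> uniq r ->
  p *m \prod_(i <- r) reset M (u i) =
  p - \sum_(i <- r) (2 * covdot M p (u i) / covdot M (u i) (u i)) *: u i.
Proof.
move=> u_orth; elim/last_ind: r => [|r j IHr].
  by rewrite !big_nil mulmx1 subr0.
rewrite rcons_uniq => /andP[j_notin_r r_uniq].
rewrite !big_rcons /= mulmxA IHr // mulmx_reset covdotBl covdot_suml.
(* The terms already subtracted are orthogonal to [u j], since [j] is not in [r]. *)
rewrite [\sum_(i <- r) covdot _ _ _]big1_seq => [|i /= i_in_r].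
  by rewrite subr0 opprD addrA.
by rewrite covdotZl (u_orth i j) ?mulr0 //; apply: contraNneq j_notin_r => <-.
Qed.

Theorem theorem2 (R : realType) (d n : nat) (M : 'M[R]_d)
    (u : 'I_n -> 'rV[R]_d) (p : 'rV[R]_d)
    (M_spd : sym_posdef M)
    (u_neq0 : forall i : 'I_n, u i != 0)
    (u_orth : forall i j : 'I_n, i != j -> covdot M (u i) (u j) = 0)
    (p_infeasible : ~ feasible M u p)
    (p_neg : forall i : 'I_n, covdot M (u i) p < 0) :
  let pf (s : 'S_n) : 'rV[R]_d := p *m \prod_(i < n) reset M (u (s i)) in
  (forall s t : 'S_n, pf s = pf t) /\ (forall s : 'S_n, feasible M u (pf s)).
Proof.
move=> pf.
pose c i := 2 * covdot M p (u i) / covdot M (u i) (u i).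
have pfE s : pf s = p - \sum_i c i *: u i.
  (* The ordering [s] becomes the duplicate-free list of its values. *)
  rewrite /pf -(big_map s xpredT (fun i => reset M (u i))).
  rewrite mulmx_prod_reset ?(map_inj_uniq perm_inj) ?index_enum_uniq //.
  (* Unlike the matrix product, the sum may be reindexed along [s]. *)
  by rewrite big_map [in RHS](reindex_inj (@perm_inj _ s)).
split=> [s t|s j]; first by rewrite !pfE.
rewrite pfE covdotBl covdot_suml (bigD1 j) //= big1 => [|i i_neq_j]; last first.
  by rewrite covdotZl (u_orth i j) ?mulr0.
(* Only the term of [j] survives; its denominator cancels, being positive. *)
rewrite addr0 covdotZl /c divfK ?gt_eqF ?covdot_gt0 //.
have -> x : x - 2 * x = - x :> R by rewrite mulr_natl mulr2n opprD addNKr.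
by rewrite oppr_ge0 (covdotC _ _ M_spd.1) ltW.
Qed.
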